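(* Let $\mathbb{K}$ be a commutative $\mathbb{Q}$-algebra, let $a \in \mathbb{K}[x]$, let $n$ be a positive integer, and let $i\in \mathbb{Z}$. For each positive divisor $d\mid n$, let $m_d \in \mathbb{K}[x]$ be such that $m_d \equiv a \pmod{\Phi_d(x)}$. Then $$\mathbf{S}^i_n(a)=\frac{1}{n}\sum_{d\mid n}{G^d_i(m_d)}.$$
   Context: $\Phi_d(x)$ denotes the $d$-th cyclotomic polynomial. For $f\in\mathbb{K}[x]$, $[x^s]f$ denotes the coefficient of $x^s$ in $f$, and $\mathbf{S}^i_n(f)=\sum_{j \equiv i \pmod n,\ j\ge 0}[x^j]f$. For an integer $l$ and positive integer $d$, the Ramanujan sum is the integer $c_d(l)=\sum_{e\mid d,\ e\mid l}\mu(d/e)\,e$ (with $\mu$ the Möbius function), regarded as an element of $\mathbb{K}$. For $m\in\mathbb{K}[x]$, $i\in\mathbb{Z}$ and a positive integer $d$, define $G^d_i(m)=\sum_{s\ge 0}[x^s]m\cdot c_d(i-s)$. *)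

(* Defs.v *)
From mathcomp Require Import all_boot all_order all_algebra all_field.

Set Implicit Arguments.
Unset Strict Implicit.
Unset Printing Implicit Defensive.

Import GRing.Theory.
Local Open Scope ring_scope.

Definition moebius (k : nat) : int :=
  if (0 < k)%N && all (fun p => logn p k == 1%N) (primes k)
  then (-1) ^+ size (primes k) else 0.

Definition ramanujan (d : nat) (l : int) : int :=
  \sum_(e <- divisors d | (e%:Z %| l)%Z) moebius (d %/ e)%N * e%:Z.

(* 'Phi_d has integer coefficients; this is its image over K. *)
Definition cyclotomic_over (K : nzRingType) (d : nat) : {poly K} :=
  map_poly intr 'Phi_d.

(* Congruence modulo the ideal (g): polydiv's %| and %% need an integral
   domain of coefficients, which K is not in general. *)
Definition eq_mod_poly (K : comNzRingType) (g p q : {poly K}) : Prop :=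
  exists h : {poly K}, p - q = h * g.

(* Coefficients vanish from index [size f] on, so the sums over all
   nonnegative indices are the finite ones below. *)
Definition residue_sum (K : nzRingType) (n : nat) (i : int) (f : {poly K}) : K :=
  \sum_(j < size f | (j%:Z == i %[mod n%:Z])%Z) f`_j.

Definition ramanujan_sum (K : nzRingType) (d : nat) (i : int) (m : {poly K}) : K :=
  \sum_(s < size m) m`_s * (ramanujan d (i - s%:Z))%:~R.

(* Main.v *)
(** Writing [z] for a primitive [d]-th root of unity, the Ramanujan sum [c_d(l)]
    is the sum of [w^l] over all primitive [d]-th roots of unity [w].  Hence
    [sum_s [x^s]f * c_d(i - s)] is the sum of [w^i f(w^-1)], which vanishes for
    [f = 'Phi_d], so [G^d_i] factors through reduction modulo ['Phi_d] and each
    [m_d] may be replaced by [a].  The formula for [a] itself is the identity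
    [sum_(d | n) c_d(l) = n] if [n] divides [l], and [0] otherwise. *)
Require Import Defs.
From mathcomp Require Import all_boot all_order all_algebra all_field.

Set Implicit Arguments.
Unset Strict Implicit.
Unset Printing Implicit Defensive.

Import GRing.Theory.
Local Open Scope ring_scope.

(** * Divisor sums of the Möbius function and of Ramanujan sums *)

Lemma moebius_mul_prime p d :
  prime p -> (0 < d)%N -> ~~ (p %| d)%N -> moebius (p * d) = - moebius d.
Proof.
move=> p_pr d_gt0 p'd; have p_gt0 := prime_gt0 p_pr.
have p_notin: p \notin primes d by rewrite mem_primes p_pr d_gt0.
have perm_pd: perm_eq (primes (p * d)) (p :: primes d).
  apply: uniq_perm; rewrite /= ?primes_uniq ?p_notin //.
  by move=> q; rewrite primesM // primes_prime // !inE.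
rewrite /moebius muln_gt0 p_gt0 d_gt0 (perm_all _ perm_pd) (perm_size perm_pd) /=.
have logn_pd q: logn q (p * d) = ((q == p) + logn q d)%N.
  by rewrite lognM // logn_prime.
have ->: logn p (p * d) == 1%N.
  by rewrite logn_pd eqxx lognE p_pr d_gt0 (negPf p'd).
have ->: all (fun q => logn q (p * d) == 1%N) (primes d)
         = all (fun q => logn q d == 1%N) (primes d).
  apply: eq_in_all => q q_d; rewrite logn_pd.
  by have /negPf->: q != p by apply: contraNneq p_notin => <-.
by rewrite /=; case: ifP; rewrite ?oppr0 // exprS mulN1r.
Qed.

Lemma moebius_sqr_dvd p d : prime p -> (p ^ 2 %| d)%N -> moebius d = 0.
Proof.
move=> p_pr p2d; rewrite /moebius; case: posnP => //= d_gt0.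
case: allP => // /(_ p); rewrite mem_primes p_pr d_gt0.
rewrite (dvdn_trans _ p2d) ?dvdn_exp // => /(_ isT) /eqP logp.
by move: p2d; rewrite pfactor_dvdn // logp.
Qed.

(** For a prime [p] dividing [n], the divisors divisible by [p ^ 2] contribute nothing, and
    [d |-> p * d] pairs the divisors prime to [p] with the remaining ones, with opposite signs. *)
Lemma sum_moebius_divisors n :
  (0 < n)%N -> \sum_(d <- divisors n) moebius d = (n == 1%N)%:R.
Proof.
move=> n_gt0; have [-> | n_neq1] := eqVneq n 1%N; first by rewrite big_seq1.
have n_gt1: (1 < n)%N by case: n n_gt0 n_neq1 => [|[|]].
have p_pr := pdiv_prime n_gt1; set p := pdiv n in p_pr.
have p_dvd: (p %| n)%N := pdiv_dvd n.
have p_gt0 := prime_gt0 p_pr.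
rewrite (bigID (fun d => p %| d)%N) /=.
rewrite (bigID (fun d => p ^ 2 %| d)%N) /= big1 ?add0r; last first.
  by move=> d /andP[_ p2d]; apply: moebius_sqr_dvd p2d.
rewrite -big_filter (perm_big (map (muln p)
  [seq d <- divisors n | ~~ (p %| d)%N])); last first.
  apply: uniq_perm.
  - by rewrite filter_uniq ?divisors_uniq.
  - by rewrite map_inj_uniq ?filter_uniq ?divisors_uniq // => x y /eqP;
      rewrite eqn_pmul2l // => /eqP.
  move=> d; rewrite mem_filter -dvdn_divisors //; apply/idP/mapP.
    case/andP=> /andP[/dvdnP[c ->]]; rewrite -mulnn dvdn_pmul2r // => p'c cp_n.
    exists c; last by rewrite mulnC.
    by rewrite mem_filter p'c -dvdn_divisors // (dvdn_trans _ cp_n) ?dvdn_mulr.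
  case=> c; rewrite mem_filter -dvdn_divisors // => /andP[p'c c_n] ->.
  rewrite dvdn_mulr // -mulnn dvdn_pmul2l // p'c Gauss_dvd ?p_dvd //.
  by rewrite prime_coprime.
rewrite big_map big_filter -big_split big_seq_cond big1 // => d.
rewrite -dvdn_divisors // => /andP[d_n p'd].
by rewrite /= moebius_mul_prime ?addNr ?(dvdn_gt0 n_gt0).
Qed.

Lemma perm_divisors_codiv n :
  (0 < n)%N -> perm_eq (divisors n) (map (divn n) (divisors n)).
Proof.
move=> n_gt0; apply: uniq_perm; rewrite ?divisors_uniq //.
  rewrite map_inj_in_uniq ?divisors_uniq // => x y.
  rewrite -!dvdn_divisors // => x_n y_n eq_xy.
  have: (n %/ (n %/ x) = n %/ (n %/ y))%N by rewrite eq_xy.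
  by rewrite !divnA // !mulKn.
move=> d; apply/idP/mapP.
  rewrite -dvdn_divisors // => d_n; exists (n %/ d)%N.
    by rewrite -dvdn_divisors // dvdn_div.
  by rewrite divnA // mulKn.
by case=> c; rewrite -!dvdn_divisors // => c_n ->; rewrite dvdn_div.
Qed.

Lemma perm_divisors_multiple n e : (0 < n)%N -> (e %| n)%N ->
  perm_eq [seq d <- divisors n | (e %| d)%N] (map (muln e) (divisors (n %/ e))).
Proof.
move=> n_gt0 e_n; have e_gt0 := dvdn_gt0 n_gt0 e_n.
have q_gt0: (0 < n %/ e)%N by rewrite divn_gt0 // dvdn_leq.
apply: uniq_perm; first by rewrite filter_uniq ?divisors_uniq.
  rewrite map_inj_uniq ?divisors_uniq // => x y /eqP.
  by rewrite eqn_pmul2l // => /eqP.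
move=> d; rewrite mem_filter -dvdn_divisors //; apply/andP/mapP.
  case=> /dvdnP[c ->] ce_n; exists c; last by rewrite mulnC.
  by rewrite -dvdn_divisors // dvdn_divRL.
case=> c; rewrite -dvdn_divisors // => c_q ->.
by rewrite dvdn_mulr // mulnC -dvdn_divRL.
Qed.

Lemma sum_moebius_multiple n e : (0 < n)%N -> (e %| n)%N ->
  \sum_(d <- divisors n | (e %| d)%N) moebius (d %/ e) = (e == n)%:R.
Proof.
move=> n_gt0 e_n; have e_gt0 := dvdn_gt0 n_gt0 e_n.
have q_gt0: (0 < n %/ e)%N by rewrite divn_gt0 // dvdn_leq.
rewrite -big_filter (perm_big _ (perm_divisors_multiple n_gt0 e_n)) big_map.
under eq_bigr do rewrite mulKn //.
by rewrite sum_moebius_divisors // -(eqn_pmul2r e_gt0) divnK // mul1n eq_sym.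
Qed.

(** Putting [d = e * c] turns the summand into the Möbius function at the codivisor of [c] in
    [n %/ e]; the involution on divisors of [n %/ e] reduces this to the plain divisor sum. It
    serves below to single out the primitive roots of unity. *)
Lemma sum_moebius_codivisor n e : (0 < n)%N -> (e %| n)%N ->
  \sum_(d <- divisors n | (e %| d)%N) moebius (n %/ d) = (e == n)%:R.
Proof.
move=> n_gt0 e_n; have e_gt0 := dvdn_gt0 n_gt0 e_n.
have q_gt0: (0 < n %/ e)%N by rewrite divn_gt0 // dvdn_leq.
rewrite -big_filter (perm_big _ (perm_divisors_multiple n_gt0 e_n)) big_map.
under eq_bigr do rewrite divnMA.
rewrite -(big_map (divn (n %/ e)) xpredT moebius).
rewrite -(perm_big _ (perm_divisors_codiv q_gt0)) sum_moebius_divisors //.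
by rewrite -(eqn_pmul2r e_gt0) divnK // mul1n eq_sym.
Qed.

Lemma sum_ramanujan n l : (0 < n)%N ->
  \sum_(d <- divisors n) ramanujan d l = if (n%:Z %| l)%Z then n%:Z else 0.
Proof.
move=> n_gt0; pose F d e := moebius (d %/ e)%N * e%:Z.
(* Letting [e] range over the divisors of [n], with [e %| d] as a condition, makes the two sums
   exchangeable; the inner Möbius sum then leaves only [e = n]. *)
transitivity (\sum_(d <- divisors n)
   \sum_(e <- divisors n | (e%:Z %| l)%Z && (e %| d)%N) F d e).
  apply: eq_big_seq => d; rewrite -dvdn_divisors // => d_n.
  have d_gt0 := dvdn_gt0 n_gt0 d_n.
  rewrite /ramanujan -big_filter -[RHS]big_filter; apply: perm_big.
  apply: uniq_perm; rewrite ?filter_uniq ?divisors_uniq // => e.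
  rewrite !mem_filter -!dvdn_divisors // -andbA; congr andb.
  by case: (boolP (e %| d)%N) => // /dvdn_trans->.
under eq_bigr do rewrite big_mkcondr.
rewrite exchange_big /=.
transitivity (\sum_(e <- divisors n | (e%:Z %| l)%Z) (e == n)%:R * e%:Z).
  rewrite big_seq_cond [RHS]big_seq_cond; apply: eq_bigr => e.
  rewrite -dvdn_divisors // => /andP[e_n _].
  by rewrite -sum_moebius_multiple // mulr_suml -big_mkcond.
rewrite big_mkcond (bigD1_seq n) ?divisors_uniq -?dvdn_divisors //=.
rewrite eqxx mul1r big1 ?addr0 // => e /negPf->.
by rewrite mul0r if_same.
Qed.

(** * Ramanujan sums as power sums of primitive roots of unity *)

Lemma prim_exprz_eq1 (F : fieldType) n (z : F) l :
  n.-primitive_root z -> (z ^ l == 1) = (n%:Z %| l)%Z.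
Proof.
move=> prim_z; rewrite dvdzE; case: l => l /=.
  by rewrite -exprnP -(prim_order_dvd prim_z).
by rewrite NegzE -exprnN invr_eq1 -(prim_order_dvd prim_z).
Qed.

Lemma sum_multiples (V : nmodType) (F : nat -> V) q e : (0 < q)%N ->
  \sum_(k < q * e | (q %| k)%N) F k = \sum_(j < e) F (q * j)%N.
Proof.
move=> q_gt0; rewrite -(big_mkord (fun k => q %| k)%N) -big_filter.
rewrite -(big_mkord xpredT (fun j => F (q * j)%N)) -(big_map (muln q) xpredT).
apply: perm_big; apply: uniq_perm; first by rewrite filter_uniq ?iota_uniq.
  rewrite map_inj_uniq ?iota_uniq // => x y /eqP.
  by rewrite eqn_pmul2l // => /eqP.
move=> k; rewrite mem_filter mem_index_iota; apply/andP/mapP.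
  case=> /dvdnP[c ->]; rewrite mulnC ltn_pmul2l // => lt_ce.
  by exists c; rewrite // mem_index_iota.
by case=> c; rewrite mem_index_iota => lt_ce ->; rewrite dvdn_mulr ?ltn_pmul2l.
Qed.

(** The [e]-th roots of unity are the powers of [z ^+ (n %/ e)], so this is a geometric sum with [e]
    terms. *)
Lemma sum_unity_roots (F : fieldType) n (z : F) e l :
    n.-primitive_root z -> (e %| n)%N ->
  \sum_(k < n | (z ^+ k) ^+ e == 1) (z ^+ k) ^ l
    = (if (e%:Z %| l)%Z then e%:Z else 0)%:~R.
Proof.
move=> prim_z e_n; have n_gt0 := prim_order_gt0 prim_z.
have e_gt0 := dvdn_gt0 n_gt0 e_n.
have Dn: n = (n %/ e * e)%N by rewrite divnK.
set q := (n %/ e)%N in Dn; have q_gt0: (0 < q)%N by rewrite divn_gt0 // dvdn_leq.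
have prim_u: e.-primitive_root (z ^+ q) by exact: dvdn_prim_root.
transitivity (\sum_(j < e) ((z ^+ q) ^ l) ^+ j).
  transitivity (\sum_(k < q * e | (q %| k)%N) (z ^+ k) ^ l); last first.
    rewrite (sum_multiples (fun k => (z ^+ k) ^ l)) //; apply: eq_bigr => j _.
    by rewrite exprM !exprnP exprzAC.
  rewrite -Dn; apply: eq_bigl => k.
  by rewrite -exprM -(prim_order_dvd prim_z) -[RHS](dvdn_pmul2r e_gt0) -Dn.
rewrite -(prim_exprz_eq1 _ prim_u); set w := (z ^+ q) ^ l.
have [-> | w_neq1] := eqVneq w 1.
  by under eq_bigr do rewrite expr1n; rewrite sumr_const card_ord.
(* Multiplied by [w - 1], the geometric sum telescopes to [w ^+ e - 1], which is zero. *)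
have w1_neq0: w - 1 != 0 by rewrite subr_eq0.
apply: (mulfI w1_neq0); apply/eqP.
rewrite mulr0 -subrX1 subr_eq0 /w exprnP exprzAC -exprnP.
by rewrite (prim_expr_order prim_u) exp1rz.
Qed.

(** Each term [e] with [e] dividing [l] is a power sum over the [e]-th roots of unity. After
    exchanging sums, a root of order [o] has as weight the sum of [moebius (n %/ e)] over
    [o %| e %| n], which is 1 if [o = n] and 0 otherwise. *)
Lemma ramanujan_unity_roots (F : fieldType) n (z : F) l :
    n.-primitive_root z ->
  (ramanujan n l)%:~R = \sum_(k < n | coprime k n) (z ^+ k) ^ l.
Proof.
move=> prim_z; have n_gt0 := prim_order_gt0 prim_z.
transitivity (\sum_(e <- divisors n) \sum_(k < n | (z ^+ k) ^+ e == 1)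
   (moebius (n %/ e)%N)%:~R * (z ^+ k) ^ l).
  rewrite /ramanujan big_mkcond rmorph_sum; apply: eq_big_seq => e.
  rewrite -dvdn_divisors // => e_n; rewrite -mulr_sumr.
  rewrite (sum_unity_roots l prim_z e_n) -intrM.
  by case: ifP; rewrite ?mulr0.
under eq_bigr do rewrite big_mkcond.
rewrite exchange_big [RHS]big_mkcond; apply: eq_bigr => k _ /=.
(* [o] is the order of [z ^+ k], so the condition on [e] becomes [o %| e]. *)
pose o := (n %/ gcdn k n)%N.
have o_prim: o.-primitive_root (z ^+ k) by exact: exp_prim_root.
have o_n: (o %| n)%N by rewrite dvdn_div ?dvdn_gcdr.
rewrite -big_mkcond.
under eq_bigl do rewrite -(prim_order_dvd o_prim).
rewrite -mulr_suml -rmorph_sum sum_moebius_codivisor //=.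
have ->: (o == n) = coprime k n.
  have g_gt0: (0 < gcdn k n)%N by rewrite gcdn_gt0 n_gt0 orbT.
  rewrite -(eqn_pmul2r g_gt0) divnK ?dvdn_gcdr // -[X in X == _]muln1.
  by rewrite eqn_pmul2l // eq_sym.
by case: ifP; rewrite ?mul1r ?mul0r.
Qed.

Lemma sum_Cyclotomic_ramanujan d i : (0 < d)%N ->
  \sum_(s < size 'Phi_d) ('Phi_d)`_s * ramanujan d (i - s%:Z) = 0.
Proof.
move=> d_gt0; have [z prim_z] := C_prim_root_exists d_gt0.
have z_neq0: z != 0 by rewrite (prim_root_eq0 prim_z) -lt0n.
(* The identity between integers is checked in [algC], where primitive roots exist. *)
apply: (intr_inj (R := algC)); rewrite rmorph_sum.
under eq_bigr => s _ do
  rewrite rmorphM /= (ramanujan_unity_roots _ prim_z) mulr_sumr.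
rewrite exchange_big big1 // => k co_k.
have prim_w: d.-primitive_root (z ^+ k) by rewrite prim_root_exp_coprime.
have w_neq0: z ^+ k != 0 by rewrite expf_neq0.
(* The exponent [i - s] calls for the value of ['Phi_d] at the inverse root, which is again
   primitive because [d.-1] is coprime to [d]. *)
have prim_wV: d.-primitive_root (z ^+ k)^-1.
  have ->: (z ^+ k)^-1 = (z ^+ k) ^+ d.-1.
    by apply: (mulfI w_neq0); rewrite mulfV // -exprS prednK // prim_expr_order.
  by rewrite prim_root_exp_coprime // coprimePn.
have /rootP: root (map_poly intr 'Phi_d) (z ^+ k)^-1.
  by rewrite (Cintr_Cyclotomic prim_z) root_cyclotomic.
rewrite horner_coef size_map_inj_poly //; last exact: intr_inj.
move=> Phi0; apply: etrans (mulr0 ((z ^+ k) ^ i)).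
rewrite -[X in _ = _ * X]Phi0 mulr_sumr; apply: eq_bigr => s _.
rewrite coef_map /= mulrCA; congr (_ * _).
by rewrite expfzDr // -exprnN exprVn.
Qed.

(** * Invariance of [ramanujan_sum] under congruence modulo the cyclotomic polynomial *)

Section RamanujanSum.

Variables (K : comNzRingType) (d : nat).
Implicit Types (p q : {poly K}) (i : int).

(** A free summation bound allows polynomials of different sizes to be compared term by term. *)
Lemma ramanujan_sum_wide N i p : (size p <= N)%N ->
  ramanujan_sum d i p = \sum_(s < N) p`_s * (ramanujan d (i - s%:Z))%:~R.
Proof.
move=> le_pN.
rewrite /ramanujan_sum (big_ord_widen _ (fun s =>
  p`_s * (ramanujan d (i - s%:Z))%:~R) le_pN) big_mkcond; apply: eq_bigr => s _.
by case: ltnP => // /(nth_default 0)->; rewrite mul0r.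
Qed.

Lemma ramanujan_sumD i p q :
  ramanujan_sum d i (p + q) = ramanujan_sum d i p + ramanujan_sum d i q.
Proof.
pose N := maxn (size p) (size q).
rewrite !(@ramanujan_sum_wide N) ?leq_maxl ?leq_maxr ?size_polyD //.
by rewrite -big_split; apply: eq_bigr => s _; rewrite coefD mulrDl.
Qed.

Lemma ramanujan_sumZ i c p :
  ramanujan_sum d i (c *: p) = c * ramanujan_sum d i p.
Proof.
rewrite (ramanujan_sum_wide _ (size_scale_leq c p)) mulr_sumr.
by apply: eq_bigr => s _; rewrite coefZ mulrA.
Qed.

Lemma ramanujan_sumMX i p :
  ramanujan_sum d i (p * 'X) = ramanujan_sum d (i - 1) p.
Proof.
rewrite (@ramanujan_sum_wide (size p).+1); last first.
  by rewrite (leq_trans (size_polyMleq _ _)) // size_polyX addn2.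
rewrite big_ord_recl coefMX mul0r add0r; apply: eq_bigr => s _.
by rewrite coefMX /= -addrA -opprD -PoszD.
Qed.

Lemma ramanujan_sum_cyclotomic i :
  (0 < d)%N -> ramanujan_sum d i (cyclotomic_over K d) = 0.
Proof.
(* With the size of the integer polynomial as bound, the sum is the image in [K] of the vanishing
   integer sum. *)
move=> d_gt0; rewrite (@ramanujan_sum_wide (size 'Phi_d)) ?size_poly //.
rewrite -[RHS](rmorph0 (intr : int -> K)) -(sum_Cyclotomic_ramanujan i d_gt0).
rewrite rmorph_sum; apply: eq_bigr => s _.
by rewrite /cyclotomic_over coef_map rmorphM.
Qed.

Lemma ramanujan_sum_mul_cyclotomic i p :
  (0 < d)%N -> ramanujan_sum d i (p * cyclotomic_over K d) = 0.
Proof.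
(* The index [i] is generalized because a factor ['X] shifts it to [i - 1]. *)
move=> d_gt0; elim/poly_ind: p i => [|p c IHp] i.
  by rewrite mul0r /ramanujan_sum size_poly0 big_ord0.
rewrite mulrDl mulrAC mul_polyC ramanujan_sumD ramanujan_sumMX IHp.
by rewrite ramanujan_sumZ ramanujan_sum_cyclotomic // mulr0 addr0.
Qed.

Lemma eq_mod_ramanujan_sum i p q : (0 < d)%N ->
  eq_mod_poly (cyclotomic_over K d) p q ->
  ramanujan_sum d i p = ramanujan_sum d i q.
Proof.
move=> d_gt0 [h /(canRL (subrK _))->].
by rewrite ramanujan_sumD ramanujan_sum_mul_cyclotomic ?add0r.
Qed.

End RamanujanSum.

(** After exchanging sums, the coefficient at [s] is multiplied by [n] if [n] divides [i - s] and by
    0 otherwise. Stating this as a multiple by [n] avoids division in [K]. *)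
Lemma sum_ramanujan_sum (K : comNzRingType) (a : {poly K}) n i : (0 < n)%N ->
  \sum_(d <- divisors n) ramanujan_sum d i a = residue_sum n i a *+ n.
Proof.
move=> n_gt0; rewrite exchange_big /residue_sum -sumrMnl [RHS]big_mkcond.
apply: eq_bigr => s _; rewrite -mulr_sumr -rmorph_sum sum_ramanujan //=.
by rewrite eq_sym eqz_mod_dvd; case: ifP; rewrite ?mulr0 // mulr_natr.
Qed.

Theorem theorem3p4 (K : comAlgType rat) (a : {poly K}) (n : nat) (i : int)
  (m : nat -> {poly K}) :
  (0 < n)%N ->
  (forall d : nat, (d %| n)%N -> eq_mod_poly (cyclotomic_over K d) (m d) a) ->
  residue_sum n i a =
    (n%:R : rat)^-1 *: \sum_(d <- divisors n) ramanujan_sum d i (m d).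
Proof.
move=> n_gt0 m_a.
transitivity ((n%:R : rat)^-1 *: \sum_(d <- divisors n) ramanujan_sum d i a).
  (* The rational algebra structure enters here: [n] is inverted in [rat] and acts on [K] by
     scaling. *)
  rewrite sum_ramanujan_sum // -scaler_nat scalerA mulVf ?scale1r //.
  by rewrite Num.Theory.pnatr_eq0 -lt0n.
congr (_ *: _); apply: eq_big_seq => d; rewrite -dvdn_divisors // => d_n.
by rewrite (eq_mod_ramanujan_sum _ (dvdn_gt0 n_gt0 d_n) (m_a d d_n)).
Qed.
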